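(* Let $\mu$ be a probability measure on $\mathbb{R}^p$ with compact support. Let $(X_i)_{i\in\mathbb{N}}$ be a sequence of i.i.d. $\mathbb{R}^p$-valued random variables with common distribution $\mu$, and for $n\ge1$ let $\mu_n=\frac1n\sum_{i=1}^n\delta_{X_i}$ be the empirical measure. Then for every positive integer $d$ such that the moment matrix $\mathbf{M}_d(\mu)$ is invertible, \[\sup_{\mathbf{x}\in\mathbb{R}^p}\left|\Lambda_{\mu_n,d}(\mathbf{x})-\Lambda_{\mu,d}(\mathbf{x})\right|\longrightarrow0\quad\text{almost surely as }n\to\infty.\]
   Context: For a finite Borel measure $\nu$ on $\mathbb{R}^p$ with finite moments and $d\in\mathbb{N}$, the Christoffel function is $\Lambda_{\nu,d}(\xi)=\min\{\int P^2\,d\nu: P\in\mathbb{R}[X]_d,\ P(\xi)=1\}$, where $\mathbb{R}[X]_d$ is the space of real polynomials in $p$ variables of total degree at most $d$; for $\mu_n$ this is $\min\{\frac1n\sum_{i=1}^nP(X_i)^2: P\in\mathbb{R}[X]_d,\ P(\xi)=1\}$. The moment matrix is $\mathbf{M}_d(\nu)=\int\mathbf{v}_d(\mathbf{x})\mathbf{v}_d(\mathbf{x})^Td\nu(\mathbf{x})$ where $\mathbf{v}_d(\mathbf{x})$ is the vector of all monomials $\mathbf{x}^\alpha$ of total degree at most $d$; when it is invertible, $\Lambda_{\nu,d}(\xi)=(\mathbf{v}_d(\xi)^T\mathbf{M}_d(\nu)^{-1}\mathbf{v}_d(\xi))^{-1}$. *)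

(* Defs.v *)
From HB Require Import structures.
From mathcomp Require Import all_boot all_order all_algebra.
From mathcomp Require Import all_classical all_reals all_analysis.
From mathcomp Require mpoly.
(* Import mpoly's canonical instances (finType on bounded monomials,
   mdeg as a measure) without its notations, which clash with analysis. *)
Import -(notations) mpoly.

Set Implicit Arguments.
Unset Strict Implicit.
Unset Printing Implicit Defensive.

Import Order.TTheory GRing.Theory Num.Theory.
Import numFieldNormedType.Exports.
Local Open Scope classical_set_scope.
Local Open Scope ring_scope.

Definition Rp (R : realType) (p : nat) : measurableType _ :=
  g_sigma_algebraType (@open 'rV[R]_p).

(* Support of a measure on R^p: points all of whose open neighbourhoods
   have positive measure (the smallest closed set of full measure). *)
Definition msupport (R : realType) (p : nat)
    (nu : set (Rp R p) -> \bar R) : set 'rV[R]_p :=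
  [set x | forall U : set 'rV[R]_p, open U -> U x -> (0 < nu U)%E].

Definition peval (R : realType) (p : nat) (P : mpoly.mpoly p R)
    (x : 'rV[R]_p) : R :=
  mpoly.meval (fun i => x ord0 i) P.

(* P \in R[X]_d : total degree at most d (msize = total degree + 1). *)
Definition deg_le (R : realType) (p : nat) (d : nat) (P : mpoly.mpoly p R) :=
  (mpoly.msize P <= d.+1)%N.

Definition admissible (R : realType) (p d : nat) (xi : 'rV[R]_p) :=
  [set P : mpoly.mpoly p R | deg_le d P /\ peval P xi = 1].

(* Christoffel function of a measure nu:
   Lambda_{nu,d}(xi) = inf { int P^2 dnu : P in R[X]_d, P(xi) = 1 }
   (the infimum is attained, so it is the min of the paper). *)
Definition christoffel (R : realType) (p : nat)
    (nu : set (Rp R p) -> \bar R) (d : nat) (xi : 'rV[R]_p) : \bar R :=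
  ereal_inf [set (\int[nu]_x ((peval P x) ^+ 2)%:E)%E
            | P in admissible d xi].

(* Christoffel function of the empirical measure mu_n = 1/n sum_{i<n} delta_{pts i}:
   inf { 1/n sum_{i<n} P(pts i)^2 : P in R[X]_d, P(xi) = 1 }. *)
Definition christoffel_emp (R : realType) (p : nat) (n : nat)
    (pts : nat -> 'rV[R]_p) (d : nat) (xi : 'rV[R]_p) : \bar R :=
  ereal_inf [set ((n%:R)^-1 * \sum_(i < n) (peval P (pts i)) ^+ 2)%:E
            | P in admissible d xi].

Definition monom (R : realType) (p : nat) (a : mpoly.multinom p)
    (x : 'rV[R]_p) : R :=
  \prod_(i < p) (x ord0 i) ^+ (mpoly.fun_of_multinom a i).

(* Moment matrix M_d(nu), indexed by the monomials of total degree <= d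
   (i.e. mdeg < d.+1), enumerated in some fixed order. *)
Definition moment_matrix (R : realType) (p : nat)
    (nu : set (Rp R p) -> \bar R) (d : nat) :
    'M[R]_(#|{: mpoly.bmultinom p d.+1}|) :=
  \matrix_(i, j)
    fine (\int[nu]_x (monom (mpoly.bmnm (enum_val i)) x
                      * monom (mpoly.bmnm (enum_val j)) x)%:E)%E.

Definition mutually_independent (dT dU : measure_display) (T : measurableType dT)
    (U : measurableType dU) (R : realType) (P : probability T R)
    (X : nat -> T -> U) : Prop :=
  forall (s : seq nat) (A : nat -> set U),
    uniq s -> (forall i, measurable (A i)) ->
    P (\bigcap_(i in [set` s]) (X i @^-1` A i)) =
    (\prod_(i <- s) P (X i @^-1` A i))%E.

(* Main.v *)
(**
The Christoffel functions are infima of the quadratic forms [c M c^T] and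
[c M_n c^T] over the same set of coefficient vectors, where [M] is the moment
matrix of [mu] and [M_n] that of the empirical measure. As [M] is positive
definite, [c_i ^ 2 <= K * c M c^T], hence [|c M_n c^T - c M c^T| <=
e_n * c M c^T] with [e_n] equal to [K] times the sum of the entries of
[|M_n - M|]. Taking infima gives [|Lambda_n - Lambda| <= e_n * Lambda <= e_n],
uniformly in the point, since the constant polynomial [1] shows that
[Lambda <= 1].

It remains to see that [M_n --> M] almost surely. Off a large ball, [mu] is
null: compact sets disjoint from the support are null, and countably many of
them cover the complement of the ball. So the monomials are essentially bounded
and the strong law follows from second moments: the squared means of the first
[m ^ 2] centered variables have summable expectations, hence tend to [0] almost
surely, and boundedness fills the gaps between consecutive squares.
*)

Require Import Defs.
From HB Require Import structures.
From mathcomp Require Import all_boot all_order all_algebra.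
From mathcomp Require Import all_classical all_reals all_analysis.
From mathcomp Require Import measurable_realfun.
From mathcomp Require mpoly.
From mathcomp Require Import ring lra.
From Stdlib Require PeanoNat.
Import -(notations) mpoly.

Import Order.TTheory GRing.Theory Num.Theory.
Import numFieldNormedType.Exports.
Local Open Scope classical_set_scope.
Local Open Scope ring_scope.

Set Implicit Arguments.
Unset Strict Implicit.
Unset Printing Implicit Defensive.

Definition quad (R : realType) (n : nat) (M : 'M[R]_n) (c : 'rV[R]_n) : R :=
  (c *m M *m c^T) ord0 ord0.

Lemma quadE (R : realType) (n : nat) (M : 'M[R]_n) (c : 'rV[R]_n) :
  quad M c = \sum_i \sum_j c ord0 i * c ord0 j * M i j.
Proof.
rewrite /quad mxE exchange_big /=; apply: eq_bigr => j _.
rewrite !mxE mulr_suml; apply: eq_bigr => i _; ring.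
Qed.

(* With [w] the [i]-th row of [invmx M], the bilinear form of [M] pairs [c] and
   [w] to [c ord0 i]; positivity at [c - t *: w] is then Cauchy-Schwarz. *)
Lemma coord_sqr_le_quad (R : realType) (n : nat) (M : 'M[R]_n) :
  M^T = M -> M \in unitmx -> (forall c, 0 <= quad M c) ->
  exists2 K : R, 0 <= K & forall (c : 'rV[R]_n) i, c ord0 i ^+ 2 <= K * quad M c.
Proof.
move=> sM uM pM.
pose k i := (invmx M) i i.
have k0 i : 0 <= k i.
  have := pM (row i (invmx M)).
  rewrite /quad -row_mul mulVmx // row1 mxE (bigD1 i) //= big1 ?addr0.
    by rewrite !mxE !eqxx mul1r.
  by move=> j /negPf ji; rewrite !mxE /= ji mul0r.
pose K := 1 + \sum_i k i.
have K0 : 0 < K by rewrite /K ltr_pwDl // sumr_ge0.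
have kK i : k i <= K.
  rewrite /K (bigD1 i) //= addrCA lerDl addr_ge0 //.
  by rewrite sumr_ge0.
exists K; first exact: ltW.
move=> c i; pose w := row i (invmx M).
have wM : w *m M = delta_mx ord0 i by rewrite /w -row_mul mulVmx // row1.
have Mw : M *m w^T = delta_mx i ord0.
  by rewrite -[M in LHS]sM -trmx_mul wM trmx_delta.
pose t := c ord0 i / K.
have := pM (c - t *: w).
have -> : quad M (c - t *: w) = quad M c - 2 * t * c ord0 i + t ^+ 2 * k i.
  have e1 : (c *m delta_mx i ord0 : 'M[R]_1) ord0 ord0 = c ord0 i.
    by rewrite -[delta_mx _ _]trmx_delta -[c in LHS]trmxK -trmx_mul -rowE !mxE.
  have e2 : (delta_mx ord0 i *m c^T : 'M[R]_1) ord0 ord0 = c ord0 i.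
    by rewrite -rowE !mxE.
  have e3 : (delta_mx ord0 i *m w^T : 'M[R]_1) ord0 ord0 = k i.
    by rewrite -rowE !mxE.
  rewrite /quad.
  have -> : (c - t *: w) *m M *m (c - t *: w)^T = c *m M *m c^T
      - t *: (c *m delta_mx i ord0) - t *: (delta_mx ord0 i *m c^T)
      + t ^+ 2 *: (delta_mx ord0 i *m w^T).
    rewrite [(c - t *: w)^T]linearB /= [(t *: w)^T]linearZ /=.
    rewrite mulmxBl mulmxBr !mulmxBl.
    rewrite -!scalemxAl wM -!scalemxAr -[c *m M *m w^T]mulmxA Mw.
    rewrite opprB scalerA -expr2 addrA addrAC -!addrA.
    by congr (_ + _); rewrite addrCA.
  have entryE (a b1 b2 b3 : 'M[R]_1) :
      (a - t *: b1 - t *: b2 + t ^+ 2 *: b3) ord0 ord0 =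
      a ord0 ord0 - t * b1 ord0 ord0 - t * b2 ord0 ord0
      + t ^+ 2 * b3 ord0 ord0 by rewrite !mxE.
  by rewrite entryE e1 e2 e3; ring.
have tk : t ^+ 2 * k i <= t ^+ 2 * K by rewrite ler_wpM2l // sqr_ge0.
have tK : t * K = c ord0 i by rewrite /t divfK // gt_eqF.
move=> h.
have {h tk} h : 0 <= quad M c - t * c ord0 i.
  apply: (le_trans h); rewrite -tK; move: tk; rewrite expr2; lra.
have := mulr_ge0 (ltW K0) h.
rewrite mulrBr mulrA [K * t]mulrC tK -expr2; lra.
Qed.

Lemma quad_dist_le (R : realType) (n : nat) (M N : 'M[R]_n) (K q : R)
    (c : 'rV[R]_n) :
  (forall i, c ord0 i ^+ 2 <= K * q) ->
  `|quad N c - quad M c| <= K * (\sum_i \sum_j `|N i j - M i j|) * q.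
Proof.
move=> cK.
have cc i j : `|c ord0 i * c ord0 j| <= K * q.
  have hi := cK i; have hj := cK j.
  rewrite normrM; set a := `|c ord0 i|; set b := `|c ord0 j|.
  have : a ^+ 2 <= K * q by rewrite /a real_normK // num_real.
  have : b ^+ 2 <= K * q by rewrite /b real_normK // num_real.
  have := sqr_ge0 (a - b); rewrite !expr2; lra.
rewrite !quadE -sumrB mulrAC mulr_sumr.
apply: le_trans (ler_norm_sum _ _ _) _; apply: ler_sum => i _.
rewrite -sumrB mulr_sumr.
apply: le_trans (ler_norm_sum _ _ _) _; apply: ler_sum => j _.
by rewrite -mulrBr normrM ler_wpM2r.
Qed.

Definition mvec (R : realType) (p d : nat) (i : 'I_#|{: mpoly.bmultinom p d.+1}|)
  (x : 'rV[R]_p) : R := monom (mpoly.bmnm (enum_val i)) x.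

Lemma peval_mvec (R : realType) (p d : nat) (Q : mpoly.mpoly p R) :
  deg_le d Q ->
  exists c : 'rV[R]_(#|{: mpoly.bmultinom p d.+1}|),
    forall x, peval Q x = \sum_i c ord0 i * mvec i x.
Proof.
move=> dQ.
exists (\row_i mpoly.mcoeff (mpoly.bmnm (enum_val i)) Q) => x.
rewrite /peval {1}(mpoly.mpolywE dQ) raddf_sum /=.
rewrite (reindex_onto enum_val enum_rank) /=; last by move=> ? _; rewrite enum_rankK.
rewrite (eq_bigl xpredT); last by move=> i; rewrite enum_valK eqxx.
apply: eq_bigr => i _.
by rewrite mpoly.mevalZ mpoly.mevalX mxE.
Qed.

Definition empirical_moment (R : realType) (p d n : nat) (pts : nat -> 'rV[R]_p) :
  'M[R]_(#|{: mpoly.bmultinom p d.+1}|) :=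
  \matrix_(i, j) (n%:R^-1 * \sum_(k < n) mvec i (pts k) * mvec j (pts k)).

Lemma sqr_lin (R : realType) (n : nat) (a b : 'I_n -> R) :
  (\sum_i a i * b i) ^+ 2 = \sum_i \sum_j a i * a j * (b i * b j).
Proof.
rewrite expr2 mulr_suml; apply: eq_bigr => i _.
rewrite mulr_sumr; apply: eq_bigr => j _; ring.
Qed.

Lemma quad_empirical (R : realType) (p d n : nat) (pts : nat -> 'rV[R]_p)
    (c : 'rV[R]_(#|{: mpoly.bmultinom p d.+1}|)) :
  n%:R^-1 * \sum_(k < n) (\sum_i c ord0 i * mvec i (pts k)) ^+ 2 =
  quad (empirical_moment d n pts) c.
Proof.
rewrite quadE; under eq_bigr do rewrite sqr_lin.
rewrite exchange_big mulr_sumr /=; apply: eq_bigr => i _.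
rewrite exchange_big mulr_sumr /=; apply: eq_bigr => j _.
rewrite mxE -mulr_sumr; ring.
Qed.

Lemma integral_sqr_mvec (R : realType) (p d : nat) (mu : probability (Rp R p) R)
    (c : 'rV[R]_(#|{: mpoly.bmultinom p d.+1}|)) :
  (forall i j : 'I_#|{: mpoly.bmultinom p d.+1}|,
    mu.-integrable setT (fun x => (mvec i x * mvec j x)%:E)) ->
  (\int[mu]_x ((\sum_i c ord0 i * mvec i x) ^+ 2)%:E)%E =
  (quad (moment_matrix mu d) c)%:E.
Proof.
move=> intv; rewrite quadE.
under eq_integral.
  move=> x _; rewrite sqr_lin -sumEFin.
  under eq_bigr do rewrite -sumEFin.
  over.
rewrite integral_sum //=; last first.
  move=> i; apply: integrable_sum => //= j _.
  by under eq_fun do rewrite EFinM; exact: integrableZl.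
rewrite -sumEFin; apply: eq_bigr => i _.
rewrite integral_sum //=; last first.
  by move=> j; under eq_fun do rewrite EFinM; exact: integrableZl.
rewrite -sumEFin; apply: eq_bigr => j _.
under eq_integral do rewrite EFinM.
rewrite integralZl // [in RHS]EFinM mxE fineK //.
exact: (integrable_fin_num _ (intv i j)).
Qed.

Lemma bounded_integrable (d : measure_display) (T : measurableType d)
    (R : realType) (mu : probability T R) (f : T -> R) (B : R) :
  measurable_fun setT f -> (forall x, `|f x| <= B) ->
  mu.-integrable setT (EFin \o f).
Proof.
move=> mf fB; apply: measurable_bounded_integrable => //.
  by have := ltry (1 : R); rewrite -(probability_setT mu).
exists B; split; first exact: num_real.
by move=> M BM x _; apply: le_trans (fB x) (ltW BM).
Qed.

Lemma integral_comp_law (dT dU : measure_display) (T : measurableType dT)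
    (U : measurableType dU) (R : realType) (P : probability T R)
    (mu : {measure set U -> \bar R}) (Y : T -> U) (f : U -> R) (B : R) :
  measurable_fun setT Y ->
  (forall A, measurable A -> P (Y @^-1` A) = mu A) ->
  measurable_fun setT f -> (forall x, `|f x| <= B) ->
  (\int[P]_w (f (Y w))%:E = \int[mu]_x (f x)%:E)%E.
Proof.
move=> mY PY mf fB.
rewrite -[RHS](@eq_measure_integral _ _ _ _ mu (pushforward P Y)) //; last first.
  by move=> A mA _; rewrite /= /pushforward PY.
rewrite integral_pushforward //.
- exact/measurable_EFinP.
- rewrite preimage_setT.
  apply: (@bounded_integrable _ _ R P (f \o Y) B); first exact: measurableT_comp.
  by move=> w; exact: fB.
Qed.

Lemma integral_prod_independent (dT dU : measure_display) (T : measurableType dT)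
    (U : measurableType dU) (R : realType) (P : probability T R)
    (mu : probability U R) (X : nat -> T -> U) (f : U -> R) (B : R) (i j : nat) :
  (forall i, measurable_fun setT (X i)) ->
  (forall i A, measurable A -> P (X i @^-1` A) = mu A) ->
  mutually_independent P X ->
  measurable_fun setT f -> (forall x, `|f x| <= B) -> i != j ->
  (\int[P]_w (f (X i w) * f (X j w))%:E =
   (\int[mu]_x (f x)%:E) * (\int[mu]_x (f x)%:E))%E.
Proof.
move=> mX PX indX mf fB ij.
pose Y w := (X i w, X j w).
have mY : measurable_fun setT Y by exact: measurable_fun_pair.
pose g (z : U * U) := f z.1 * f z.2.
have mg : measurable_fun setT g.
  apply: measurable_funM; apply: measurableT_comp => //.
have gB z : `|g z| <= B * B by rewrite normrM ler_pM.
have rect (A C : set U) : measurable A -> measurable C ->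
    P (Y @^-1` (A `*` C)) = (mu A * mu C)%E.
  move=> mA mC; pose E k := if k == i then A else C.
  have := indX [:: i; j] E.
  rewrite /= inE ij /= => /(_ isT) h.
  have -> : Y @^-1` (A `*` C) = \bigcap_(k in [set` [:: i; j]]) (X k @^-1` E k).
    apply/seteqP; split=> w /=.
      move=> [Aw Cw] k /=; rewrite !inE => /orP[/eqP->|/eqP->]; rewrite /E ?eqxx //.
      by rewrite eq_sym (negPf ij).
    move=> h'; split.
      by have /= := h' i; rewrite /E eqxx; apply; rewrite !inE eqxx.
    have /= := h' j; rewrite /E eq_sym (negPf ij); apply.
    by rewrite !inE eqxx orbT.
  rewrite h; last by move=> k; rewrite /E; case: ifP.
  rewrite big_cons big_seq1 /E eqxx eq_sym (negPf ij).
  by rewrite !PX.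
have law A : measurable A -> P (Y @^-1` A) = (mu \x mu)%E A.
  move=> mA; symmetry.
  by apply: (@product_measure_unique _ _ U U R mu mu (pushforward P Y)).
rewrite (@integral_comp_law _ _ _ _ _ P (mu \x mu)%E Y g (B * B)) //.
have ig : (mu \x mu)%E.-integrable setT (EFin \o g).
  apply: measurable_bounded_integrable => //.
    have mu2T : (mu \x mu)%E [set: U * U] = 1%E.
      rewrite -setXTT product_measure1E //.
      rewrite -[X in (X * _)%E]/(mu [set: U]) -[X in (_ * X)%E]/(mu [set: U]).
      by rewrite !probability_setT mule1.
    by rewrite [ltLHS]mu2T ltry.
  exists (B * B); split; first exact: num_real.
  by move=> M BM z _; apply: le_trans (gB z) (ltW BM).
rewrite -(integral12_prod_meas1 ig) /=.
have intf := @bounded_integrable _ U R mu f B mf fB.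
have fint := integrable_fin_num measurableT intf.
set m := (\int[mu]_x (f x)%:E)%E in fint *.
transitivity (\int[mu]_x ((f x)%:E * m))%E.
  apply: eq_integral => x _; rewrite -integralZl //.
transitivity (\int[mu]_x ((f x)%:E * (fine m)%:E))%E; first by rewrite fineK.
by rewrite integralZr // fineK.
Qed.

Lemma second_moment_sum (dT dU : measure_display) (T : measurableType dT)
    (U : measurableType dU) (R : realType) (P : probability T R)
    (mu : probability U R) (X : nat -> T -> U) (f : U -> R) (B : R) (n : nat) :
  (forall i, measurable_fun setT (X i)) ->
  (forall i A, measurable A -> P (X i @^-1` A) = mu A) ->
  mutually_independent P X ->
  measurable_fun setT f -> (forall x, `|f x| <= B) ->
  (\int[mu]_x (f x)%:E = 0)%E ->
  (\int[P]_w ((\sum_(i < n) f (X i w)) ^+ 2)%:E <= (n%:R * B ^+ 2)%:E)%E.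
Proof.
move=> mX PX indX mf fB f0.
have mfX i : measurable_fun setT (fun w => f (X i w)).
  by apply: measurableT_comp.
have iff i j : P.-integrable setT (fun w => (f (X i w) * f (X j w))%:E).
  apply: (@bounded_integrable _ T R P (fun w => f (X i w) * f (X j w)) (B * B)).
    exact: measurable_funM.
  by move=> w; rewrite normrM ler_pM.
under eq_integral.
  move=> w _; rewrite expr2 mulr_suml -sumEFin.
  under eq_bigr do rewrite mulr_sumr -sumEFin.
  over.
rewrite integral_sum //=; last by move=> i; exact: integrable_sum.
under eq_bigr do rewrite integral_sum //=.
have -> : (n%:R * B ^+ 2)%:E = (\sum_(i < n) (B ^+ 2)%:E)%E.
  by rewrite sumEFin sumr_const card_ord mulr_natl.
apply: lee_sum => i _.
rewrite (bigD1 i) //= big1 ?adde0; last first.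
  move=> j ji; rewrite (@integral_prod_independent _ _ _ _ _ _ mu X f B) //.
    by rewrite f0 mule0.
  by rewrite eq_sym; apply: contra ji => /eqP/val_inj ->.
have -> : (B ^+ 2)%:E = (\int[P]_w (B ^+ 2)%:E)%E.
  by rewrite integral_cst // [X in (_ * X)%E]probability_setT mule1.
apply: ge0_le_integral => //.
- by move=> w _; rewrite lee_fin -expr2 sqr_ge0.
- by apply/measurable_EFinP; exact: measurable_funM.
- move=> w _; rewrite lee_fin -expr2 -[leLHS]real_normK ?num_real //.
  by rewrite lerXn2r ?nnegrE // (le_trans _ (fB (X i w))).
Qed.

Lemma ae_cvg0_of_summable_integral (d : measure_display) (T : measurableType d)
    (R : realType) (mu : {measure set T -> \bar R}) (a : nat -> T -> R)
    (b : nat -> R) (C : R) :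
  (forall n, measurable_fun setT (a n)) -> (forall n w, 0 <= a n w) ->
  (forall n, (\int[mu]_w (a n w)%:E <= (b n)%:E)%E) ->
  (forall n, \sum_(0 <= k < n) b k <= C) ->
  {ae mu, forall w, a n w @[n --> \oo] --> (0 : R)}.
Proof.
move=> ma a0 ab bC.
have mEa n : measurable_fun setT (fun w => (a n w)%:E) by exact/measurable_EFinP.
have Ea0 n w : (0 <= (a n w)%:E)%E by rewrite lee_fin.
pose S w := (\sum_(n <oo) (a n w)%:E)%E.
have mS : measurable_fun setT S.
  by apply: ge0_emeasurable_sum.
have S0 w : (0 <= S w)%E by exact: nneseries_ge0.
have intS : mu.-integrable setT S.
  apply/integrableP; split => //.
  under eq_integral do rewrite gee0_abs //.
  rewrite integral_nneseries //.
  apply: (@le_lt_trans _ _ C%:E); last exact: ltry.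
  apply: lime_le.
    by apply: is_cvg_nneseries => n _ _; apply: integral_ge0.
  apply: nearW => n; apply: le_trans (_ : (\sum_(0 <= k < n) (b k)%:E <= _)%E).
    exact: lee_sum.
  by rewrite sumEFin lee_fin.
have := integrable_ae measurableT intS.
apply: filterS => w /(_ I) finS.
have tail : (\sum_(N <= k <oo) (a k w)%:E)%E @[N --> \oo] --> 0%E.
  apply: nneseries_tail_cvg => //.
  by rewrite ltey_eq finS.
suff /fine_cvgP[_] : (a n w)%:E @[n --> \oo] --> 0%:E by [].
apply: squeeze_cvge tail; [|exact: cvg_cst].
apply: nearW => n; rewrite Ea0 /=.
have := @nneseries_lim_ge R (fun k => (a k w)%:E) xpredT n n.+1.
by rewrite big_nat1; apply.
Qed.

(* Between consecutive squares [m ^ 2 <= k < m.+1 ^ 2] the partial sum moves by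
   at most [2 * m * B], which is negligible against [k]. *)
Lemma cvg_mean_of_squares (R : realType) (s : nat -> R) (B : R) :
  (forall i, `|s i| <= B) ->
  (((n.+1 ^ 2)%:R)^-1 * \sum_(0 <= i < n.+1 ^ 2) s i) ^+ 2 @[n --> \oo]
    --> (0 : R) ->
  n%:R^-1 * (\sum_(0 <= i < n) s i) @[n --> \oo] --> (0 : R).
Proof.
move=> sB cv; apply/cvgr0Pnorm_le => e e0.
have B0 : 0 <= B by rewrite (le_trans _ (sB 0%N)).
have e2gt0 : 0 < e / 2 by rewrite divr_gt0.
have e20 : 0 < (e / 2) ^+ 2 by rewrite exprn_gt0.
have /cvgr0Pnorm_le/(_ _ e20) [N1 _ hN1] := cv.
pose N2 := Num.truncn (4 * B / e).
have hN2 m : (N2 < m)%N -> 4 * B <= m%:R * e.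
  move=> Nm; rewrite -ler_pdivrMr //; apply: ltW.
  apply: (lt_le_trans (truncnS_gt _)); by rewrite ler_nat.
exists ((N1 + N2).+2 ^ 2)%N => // k /= hk.
have [m1 m2] :
    (PeanoNat.Nat.sqrt k ^ 2 <= k)%N /\ (k < (PeanoNat.Nat.sqrt k).+1 ^ 2)%N.
  have [h1 h2] := PeanoNat.Nat.sqrt_spec k (PeanoNat.Nat.le_0_l k).
  by split; rewrite -mulnn; [apply/ssrnat.leP|apply/ssrnat.ltP].
set m := PeanoNat.Nat.sqrt k in m1 m2.
have Nm : (N1 + N2 < m)%N.
  have : ((N1 + N2).+2 ^ 2 < m.+1 ^ 2)%N by exact: leq_ltn_trans hk m2.
  by rewrite ltn_exp2r // ltnS => /ltnW.
have mgt0 : (0 < m)%N by exact: leq_ltn_trans Nm.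
have kgt0 : (0 < k)%N by apply: leq_trans m1; rewrite expn_gt0 mgt0.
have Sm : `|\sum_(0 <= i < m ^ 2) s i| <= (m ^ 2)%:R * (e / 2).
  have /= := hN1 m.-1; rewrite prednK // => /(_ _).
  have -> : (N1 <= m.-1)%N.
    by rewrite -ltnS prednK // (leq_ltn_trans _ Nm) // leq_addr.
  move=> /(_ isT); rewrite normrX ler_sqr ?nnegrE ?normr_ge0 ?(ltW e2gt0) //.
  have m2gt0 : 0 < (m ^ 2)%:R :> R by rewrite ltr0n expn_gt0 mgt0.
  by rewrite normrM normfV (gtr0_norm m2gt0) mulrC ler_pdivrMr // mulrC.
have Sk : `|\sum_(m ^ 2 <= i < k) s i| <= (2 * m)%:R * B.
  apply: (le_trans (ler_norm_sum _ _ _)).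
  apply: (@le_trans _ _ (\sum_(m ^ 2 <= i < k) B)); first exact: ler_sum.
  rewrite big_const_nat iter_addr addr0 mulr_natl.
  rewrite -[leLHS]mulr_natl -[leRHS]mulr_natl.
  rewrite ler_wpM2r // ler_nat leq_subLR -ltnS.
  by move: m2; rewrite -[m.+1]addn1 sqrnD muln1 exp1n addnAC addn1.
rewrite normrM normfV normr_nat mulrC ler_pdivrMr ?ltr0n //.
rewrite (big_cat_nat (n := (m ^ 2)%N)) //=.
apply: (le_trans (ler_normD _ _)); apply: (le_trans (lerD Sm Sk)).
have hm : 4 * B <= m%:R * e by apply: hN2; apply: leq_ltn_trans Nm; rewrite leq_addl.
have hk2 : (m ^ 2)%:R * e <= e * k%:R.
  by rewrite mulrC ler_wpM2l ?(ltW e0) // ler_nat.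
apply: le_trans hk2.
have m0 : 0 <= m%:R :> R by [].
have := ler_wpM2l m0 hm.
rewrite natrX natrM expr2; lra.
Qed.

Lemma sum_inv_sqr_le (R : realType) (n : nat) :
  \sum_(0 <= k < n) (k.+1%:R ^+ 2)^-1 <= 2 - 2 / n.+1%:R :> R.
Proof.
elim: n => [|n IH]; first by rewrite big_geq // divr1 subrr.
rewrite big_nat_recr //=; apply: (le_trans (lerD IH (lexx _))).
have -> : n.+2%:R = n%:R + 2 :> R by rewrite -addn2 natrD.
have -> : n.+1%:R = n%:R + 1 :> R by rewrite -addn1 natrD.
have n0 : 0 <= n%:R :> R by [].
set x := n%:R in n0 *.
have -> : 2 - 2 / (x + 2) = 2 - 2 / (x + 1) + 2 / ((x + 1) * (x + 2)).
  by field; rewrite !gt_eqF //=; lra.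
rewrite lerD2l ler_pdivlMr; last by apply: mulr_gt0; lra.
rewrite mulrC ler_pdivrMr; last by apply: exprn_gt0; lra.
rewrite expr2; nra.
Qed.

Lemma strong_law_centered (dT dU : measure_display) (T : measurableType dT)
    (U : measurableType dU) (R : realType) (P : probability T R)
    (mu : probability U R) (X : nat -> T -> U) (f : U -> R) (B : R) :
  (forall i, measurable_fun setT (X i)) ->
  (forall i A, measurable A -> P (X i @^-1` A) = mu A) ->
  mutually_independent P X ->
  measurable_fun setT f -> (forall x, `|f x| <= B) ->
  (\int[mu]_x (f x)%:E = 0)%E ->
  {ae P, forall w, n%:R^-1 * (\sum_(0 <= i < n) f (X i w)) @[n --> \oo] --> (0 : R)}.
Proof.
move=> mX PX indX mf fB f0.
pose a n w := (((n.+1 ^ 2)%:R)^-1 * \sum_(0 <= i < n.+1 ^ 2) f (X i w)) ^+ 2.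
have mS n : measurable_fun setT (fun w => \sum_(0 <= i < n) f (X i w)).
  by apply: measurable_sum => i; exact: measurableT_comp.
have ma n : measurable_fun setT (a n).
  by apply: measurable_funX; apply: measurable_funM.
have : {ae P, forall w, a n w @[n --> \oo] --> (0 : R)}.
  apply: (@ae_cvg0_of_summable_integral _ _ _ _ _
    (fun n => B ^+ 2 * (n.+1%:R ^+ 2)^-1) (B ^+ 2 * 2)) => //.
  - by move=> n w; exact: sqr_ge0.
  - move=> n; set k := (n.+1 ^ 2)%N.
    have k0 : (0 < k)%N by rewrite expn_gt0.
    have -> : (\int[P]_w (a n w)%:E = ((k%:R^-1) ^+ 2)%:E *
        \int[P]_w ((\sum_(i < k) f (X i w)) ^+ 2)%:E)%E.
      rewrite -ge0_integralZl //.
      - by apply: eq_integral => w _; rewrite /a exprMn EFinM big_mkord.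
      - apply/measurable_EFinP/measurable_funX.
        rewrite (_ : (fun w => _) = fun w => \sum_(0 <= i < k) f (X i w)) //.
        by apply/funext => w; rewrite big_mkord.
      - by move=> w _; rewrite lee_fin sqr_ge0.
    have := @second_moment_sum _ _ _ _ _ P mu X f B k mX PX indX mf fB f0.
    have ki : (0 <= ((k%:R^-1 : R) ^+ 2)%:E)%E by rewrite lee_fin sqr_ge0.
    move=> /(lee_wpmul2l ki) /le_trans; apply.
    rewrite -EFinM lee_fin -natrX -/k expr2 -mulrA [X in _ * X]mulrA.
    by rewrite mulVf ?pnatr_eq0 -?lt0n // mul1r mulrC.
  - move=> n; rewrite -mulr_sumr ler_wpM2l ?sqr_ge0 //.
    apply: (le_trans (sum_inv_sqr_le R n)); rewrite gerBl.
    by rewrite divr_ge0.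
apply: filterS => w; apply: cvg_mean_of_squares => i; exact: fB.
Qed.

Lemma strong_law_ae_bounded (dT dU : measure_display) (T : measurableType dT)
    (U : measurableType dU) (R : realType) (P : probability T R)
    (mu : probability U R) (X : nat -> T -> U) (f : U -> R) (B : R) :
  (forall i, measurable_fun setT (X i)) ->
  (forall i A, measurable A -> P (X i @^-1` A) = mu A) ->
  mutually_independent P X ->
  measurable_fun setT f -> {ae mu, forall x, `|f x| <= B} ->
  {ae P, forall w, n%:R^-1 * (\sum_(i < n) f (X i w)) @[n --> \oo] -->
    fine (\int[mu]_x (f x)%:E)%E}.
Proof.
move=> mX PX indX mf fB.
pose g x := Num.min (Num.max (f x) (- `|B|)) `|B|.
have mg : measurable_fun setT g.
  apply: measurable_minr; last exact: measurable_cst.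
  by apply: measurable_maxr => //; exact: measurable_cst.
have gB x : `|g x| <= `|B|.
  rewrite ler_norml /g ge_min lexx orbT andbT le_min le_max lexx orbT /=.
  by rewrite (le_trans _ (normr_ge0 B)) // oppr_le0.
have gf x : `|f x| <= B -> g x = f x.
  move=> fx; have := le_trans fx (ler_norm B); rewrite ler_norml => /andP[h1 h2].
  by rewrite /g (max_idPl h1) (min_idPl h2).
have ig : mu.-integrable setT (fun x => (g x)%:E).
  exact: (@bounded_integrable _ U R mu g `|B|).
set m := fine (\int[mu]_x (f x)%:E)%E.
have gm : (\int[mu]_x (g x)%:E = m%:E)%E.
  have fgE : (\int[mu]_x (f x)%:E = \int[mu]_x (g x)%:E)%E.
    apply: ae_eq_integral => //; try exact/measurable_EFinP.
    by apply: filterS fB => x fx _; rewrite gf.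
  by rewrite /m fgE fineK // integrable_fin_num.
have ici : mu.-integrable setT (fun=> m%:E).
  exact: (@bounded_integrable _ U R mu (cst m) `|m|).
have h0 : (\int[mu]_x (g x - m)%:E = 0)%E.
  under eq_integral do rewrite EFinB.
  rewrite integralB // gm integral_cst // [X in (_ * X)%E]probability_setT mule1.
  by rewrite subee.
have sl := @strong_law_centered _ _ _ _ _ P mu X (fun x => g x - m) (`|B| + `|m|)
  mX PX indX _ _ h0.
have fX : {ae P, forall w, forall i, `|f (X i w)| <= B}.
  apply: ae_foralln => i; have [N [mN N0 hN]] := fB.
  exists (X i @^-1` N); split.
  - by rewrite -[X in measurable X]setTI; exact: mX.
  - exact: etrans (PX i N mN) N0.
  - by move=> w /= h; apply: hN.
apply: filterS2 fX (sl _ _) => [w fw cv||]; last 2 first.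
- by apply: measurable_funB => //; exact: measurable_cst.
- by move=> x; rewrite (le_trans (ler_normB _ _)) // lerD.
have -> : m = 0 + m by rewrite add0r.
have : n%:R^-1 * (\sum_(0 <= i < n) (g (X i w) - m)) + m @[n --> \oo] --> 0 + m.
  by apply: cvgD => //; exact: cvg_cst.
apply: cvg_trans; apply: near_eq_cvg; exists 1%N => // n /= n0.
rewrite big_mkord sumrB sumr_const card_ord -[m *+ n]mulr_natl mulrBr mulKf.
  by rewrite subrK; congr (_ * _); apply: eq_bigr => i _; rewrite gf.
by rewrite pnatr_eq0 -lt0n.
Qed.

Lemma measurable_fun_of_continuous (R : realType) (p : nat) (f : 'rV[R]_p -> R) :
  continuous f -> measurable_fun [set: Rp R p] f.
Proof.
move=> cf; apply: (measurability _ (RGenOpens.measurableE R)).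
move=> _ [_ [a [b ->] <-]]; rewrite setTI.
apply: sub_sigma_algebra; apply: open_comp; first by move=> x _; exact: cf.
exact: interval_open.
Qed.

Lemma measurable_monom (R : realType) (p : nat) (a : mpoly.multinom p) :
  measurable_fun [set: Rp R p] (@monom R p a).
Proof.
suff h s : measurable_fun [set: Rp R p] (fun x : 'rV[R]_p =>
    \prod_(i <- s) x ord0 i ^+ mpoly.fun_of_multinom a i) by exact: h.
elim: s => [|i s IH].
  by under eq_fun do rewrite big_nil; exact: measurable_cst.
under eq_fun do rewrite big_cons.
apply: measurable_funM => //; apply: measurable_funX.
apply: measurable_fun_of_continuous; exact: coord_continuous.
Qed.

Lemma monom_le (R : realType) (p : nat) (a : mpoly.multinom p) (N : R)
    (x : 'rV[R]_p) :
  `|x| <= N -> `|monom a x| <= \prod_(i < p) N ^+ (mpoly.fun_of_multinom a i).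
Proof.
move=> xN; rewrite /monom normr_prod; apply: ler_prod => i _.
rewrite normr_ge0 /= normrX lerXn2r ?nnegrE ?normr_ge0 //.
  by rewrite (le_trans _ xN).
apply: le_trans xN; rewrite [leRHS]/Num.norm /= mx_normrE.
by apply/bigmax_geP; right => /=; exists (ord0, i).
Qed.

Lemma negligible_compact_off_support (R : realType) (p : nat) (mu : probability (Rp R p) R)
    (K : set 'rV[R]_p) :
  compact K -> K `&` msupport mu = set0 -> mu.-negligible (K : set (Rp R p)).
Proof.
move=> cK Ks.
have hU x : exists U : set 'rV[R]_p,
    K x -> [/\ open U, U x & mu (U : set (Rp R p)) = 0%E].
  have [Kx|nKx] := pselect (K x); last by exists set0.
  have : ~ msupport mu x by move=> sx; rewrite -[False]/(set0 x) -Ks.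
  move=> /existsNP[U] /not_implyP[oU] /not_implyP[Ux nU].
  exists U => _; split => //; apply/eqP; rewrite eq_le measure_ge0 andbT.
  by rewrite leNgt; apply/negP.
pose U x := sval (cid (hU x)).
have UP x : K x -> [/\ open (U x), U x x & mu (U x : set (Rp R p)) = 0%E].
  by rewrite /U; case: cid.
move: cK; rewrite compact_cover => /(_ _ K U) [].
- by move=> x /UP[].
- by move=> x Kx; exists x => //; have [] := UP x Kx.
move=> D DK; rewrite /cover bigcup_fset => KD.
apply: (@negligibleS _ (Rp R p) R mu _ K KD); rewrite big_seq.
elim/big_ind: _ => //.
- exact: negligible_set0.
- by move=> A B hA hB; exact: (@negligibleU _ (Rp R p) R mu A B hA hB).
- move=> x /DK; rewrite inE => /UP[oU _ U0]; exists (U x); split => //.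
  exact: sub_sigma_algebra.
Qed.

Lemma compact_support_bounded (R : realType) (p : nat)
    (mu : probability (Rp R p) R) :
  compact (msupport mu) ->
  exists2 N : R, 0 <= N & {ae mu, forall x : Rp R p, `|x : 'rV[R]_p| <= N}.
Proof.
move=> /compact_bounded[M [_ hM]].
pose N := `|M| + 2; exists N; first by rewrite addr_ge0.
pose K (k : nat) := [set x : 'rV[R]_p | N <= `|x|] `&` [set x | `|x| <= k%:R].
have Knull k : mu.-negligible (K k : set (Rp R p)).
  apply: negligible_compact_off_support.
    apply: bounded_closed_compact.
      exists k%:R; split; first exact: num_real.
      by move=> y ky x [_ /= /le_trans]; apply; exact: ltW.
    apply: closedI.
      apply: (@preimage_closed _ _ (fun x : 'rV[R]_p => `|x|) [set y | N <= y]).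
        by move=> x _; exact: norm_continuous.
      exact: closed_ge.
    apply: (@preimage_closed _ _ (fun x : 'rV[R]_p => `|x|) [set y | y <= k%:R]).
      by move=> x _; exact: norm_continuous.
    exact: closed_le.
  apply/seteqP; split => // x [[/= Nx _]] sx.
  have MN : M < `|M| + 1 by rewrite (le_lt_trans (ler_norm _)) // ltrDl.
  have := hM _ MN x sx; move: Nx; rewrite /N => h1 h2.
  by have := le_trans h1 h2; rewrite lerD2l; lra.
apply: negligibleS (negligible_bigcup Knull) => x /= /negP; rewrite -ltNge => Nx.
exists (Num.truncn `|x : 'rV[R]_p|).+1 => //; split; first exact: ltW.
by rewrite /= ltW // truncnS_gt.
Qed.

Lemma ae_bounded_integrable (d : measure_display) (T : measurableType d)
    (R : realType) (mu : probability T R) (f : T -> R) (B : R) :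
  measurable_fun setT f -> {ae mu, forall x, `|f x| <= B} ->
  mu.-integrable setT (fun x => (f x)%:E).
Proof.
move=> mf [N [mN N0 hN]].
apply/(negligible_integrable mN measurableT _ N0).
  exact/measurable_EFinP.
apply: (measurable_bounded_integrable (f := f)).
- exact: measurableD.
- apply: le_lt_trans (ltry 1); rewrite -(probability_setT mu).
  by apply: le_measure; rewrite ?inE //; exact: measurableD.
- exact: measurable_funTS.
exists B; split; first exact: num_real.
move=> M BM x [_ Nx]; apply: le_trans (ltW BM).
by apply: contrapT => fx; apply/Nx/hN.
Qed.

Lemma ereal_inf_dist_le (R : realType) (T : Type) (A : set T) (q q' : T -> R)
    (e : R) (t0 : T) :
  (forall t, A t -> 0 <= q t) -> (forall t, A t -> 0 <= q' t) ->
  (forall t, A t -> `|q' t - q t| <= e * q t) -> 0 <= e ->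
  A t0 -> q t0 <= 1 ->
  (`|ereal_inf [set (q' t)%:E | t in A] - ereal_inf [set (q t)%:E | t in A]|
    <= e%:E)%E.
Proof.
move=> q0 q'0 qq' e0 At0 qt0.
have inf_real (r : T -> R) : (forall t, A t -> 0 <= r t) ->
    exists2 l : R, ereal_inf [set (r t)%:E | t in A] = l%:E &
      [/\ 0 <= l, forall t, A t -> l <= r t
        & forall b, (forall t, A t -> b <= r t) -> b <= l].
  move=> r0; set I := ereal_inf _.
  have lbI b : (forall t, A t -> b <= r t) -> (b%:E <= I)%E.
    by move=> hb; apply/ereal_infP => _ [t At <-]; rewrite lee_fin hb.
  have Ilb t : A t -> (I <= (r t)%:E)%E.
    by move=> At; apply: ereal_inf_lbound; exists t.
  have I0 : (0 <= I)%E by exact: (lbI 0).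
  have Ifin : I \is a fin_num.
    by rewrite ge0_fin_numE // (le_lt_trans (Ilb _ At0)) // ltry.
  exists (fine I); first by rewrite fineK.
  split; first exact: fine_ge0.
  - by move=> t At; rewrite -lee_fin fineK // Ilb.
  - by move=> b hb; rewrite -lee_fin fineK // lbI.
have [l -> [l0 lq ql]] := inf_real q q0.
have [l' -> [l'0 lq' ql']] := inf_real q' q'0.
rewrite -EFinB -[leLHS]/(`|l' - l|%:E) lee_fin.
have l1 : l <= 1 by apply: le_trans qt0; exact: lq.
have h1 : l' <= (1 + e) * l.
  have e1 : 0 < 1 + e by rewrite ltr_pwDl.
  rewrite mulrC -ler_pdivrMr //; apply: ql => t At.
  rewrite ler_pdivrMr // (le_trans (lq' t At)) //.
  have := qq' t At; rewrite ler_norml => /andP[_]; lra.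
have h2 : (1 - e) * l <= l'.
  have [e1|e1] := leP e 1.
    apply: ql' => t At; apply: (@le_trans _ _ ((1 - e) * q t)).
      by rewrite ler_wpM2l ?subr_ge0 // lq.
    have := qq' t At; rewrite ler_norml => /andP[+ _]; lra.
  by apply: le_trans l'0; rewrite mulr_le0_ge0 // subr_le0 ltW.
rewrite ler_norml; apply/andP; split; nra.
Qed.

Lemma cvg0_sum (R : realType) (I : finType) (u : I -> nat -> R) :
  (forall i, u i n @[n --> \oo] --> (0 : R)) ->
  \sum_i u i n @[n --> \oo] --> (0 : R).
Proof.
move=> cu; elim: (index_enum I) => [|i s IH].
  by under eq_fun do rewrite big_nil; exact: cvg_cst.
under eq_fun do rewrite big_cons.
have : u i n + \sum_(j <- s) u j n @[n --> \oo] --> (0 + 0 : R) by exact: cvgD.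
by rewrite addr0.
Qed.

Lemma christoffel_dist_le (R : realType) (p d n : nat)
    (mu : probability (Rp R p) R) (pts : nat -> 'rV[R]_p) (e : R) :
  (forall i j : 'I_#|{: mpoly.bmultinom p d.+1}|,
    mu.-integrable setT (fun x => (mvec i x * mvec j x)%:E)) ->
  (forall c, `|quad (empirical_moment d n pts) c - quad (moment_matrix mu d) c|
    <= e * quad (moment_matrix mu d) c) ->
  0 <= e -> forall x,
  (`|christoffel_emp n pts d x - christoffel mu d x| <= e%:E)%E.
Proof.
move=> intv he e0 x.
pose q (Q : mpoly.mpoly p R) := fine (\int[mu]_y (peval Q y ^+ 2)%:E)%E.
pose q' (Q : mpoly.mpoly p R) := n%:R^-1 * \sum_(i < n) peval Q (pts i) ^+ 2.
have qE Q (c : 'rV[R]_(#|{: mpoly.bmultinom p d.+1}|)) :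
    (forall y, peval Q y = \sum_i c ord0 i * mvec i y) ->
    (\int[mu]_y (peval Q y ^+ 2)%:E)%E = (quad (moment_matrix mu d) c)%:E.
  by move=> Qc; under eq_integral do rewrite Qc; exact: integral_sqr_mvec.
have -> : christoffel mu d x = ereal_inf [set (q Q)%:E | Q in admissible d x].
  congr ereal_inf; apply: eq_imagel => Q [/peval_mvec[c Qc] _].
  by rewrite /q (qE _ _ Qc).
rewrite -[christoffel_emp _ _ _ _]/(ereal_inf [set (q' Q)%:E | Q in admissible d x]).
apply: (@ereal_inf_dist_le _ _ _ _ _ _ (1 : mpoly.mpoly p R)) => //.
- by move=> Q _; rewrite fine_ge0 // integral_ge0 // => y _; rewrite lee_fin sqr_ge0.
- by move=> Q _; rewrite mulr_ge0 ?invr_ge0 // sumr_ge0 // => i _; rewrite sqr_ge0.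
- move=> Q [/peval_mvec[c Qc] _]; rewrite /q (qE _ _ Qc) /= /q'.
  by under eq_bigr do rewrite Qc; rewrite quad_empirical.
- by split; [rewrite /deg_le mpoly.msize1|rewrite /peval mpoly.meval1].
- rewrite /q; under eq_integral do rewrite /peval mpoly.meval1 expr1n.
  by rewrite integral_cst // [X in (_ * X)%E]probability_setT mule1.
Qed.

Unset Implicit Arguments.

Theorem theorem3p12 (R : realType) (p : nat) (mu : probability (Rp R p) R)
  (dT : measure_display) (T : measurableType dT) (P : probability T R)
  (X : nat -> T -> Rp R p) :
  compact (msupport mu) ->
  (forall i, measurable_fun setT (X i)) ->
  (forall i (A : set (Rp R p)), measurable A -> P (X i @^-1` A) = mu A) ->
  mutually_independent P X ->
  forall d : nat, (0 < d)%N -> moment_matrix mu d \in unitmx ->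
  {ae P, forall w,
    (fun n : nat => ereal_sup
       [set `| christoffel_emp n (fun i => X i w) d x - christoffel mu d x |%E
       | x in [set: 'rV[R]_p]]) @ \oo --> 0%E}.
Proof.
move=> cs mX PX indX d _ uM.
have [N N0 hN] := compact_support_bounded cs.
set M := moment_matrix mu d in uM *.
set I := #|{: mpoly.bmultinom p d.+1}| in M uM *.
pose V (i j : 'I_I) (x : Rp R p) := mvec i x * mvec j x.
have mV i j : measurable_fun setT (V i j).
  by apply: measurable_funM; exact: measurable_monom.
pose b (i : 'I_I) :=
  \prod_(k < p) N ^+ mpoly.fun_of_multinom (mpoly.bmnm (enum_val i)) k.
have bV i j : {ae mu, forall x, `|V i j x| <= b i * b j}.
  by apply: filterS hN => x xN; rewrite normrM ler_pM // monom_le.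
have intV i j : mu.-integrable setT (fun x => (V i j x)%:E).
  exact: ae_bounded_integrable (mV i j) (bV i j).
have symM : M^T = M.
  apply/matrixP => i j; rewrite !mxE; congr fine; apply: eq_integral => x _.
  by rewrite mulrC.
have psdM c : 0 <= quad M c.
  rewrite -lee_fin -(integral_sqr_mvec c intV) integral_ge0 // => x _.
  by rewrite lee_fin sqr_ge0.
have [K K0 hK] := coord_sqr_le_quad symM uM psdM.
have slln : {ae P, forall w, forall i j : 'I_I,
    empirical_moment d n (fun k => X k w) i j @[n --> \oo] --> M i j}.
  apply: filter_forall => i; apply: filter_forall => j.
  have := strong_law_ae_bounded mX PX indX (mV i j) (bV i j).
  apply: filterS => w; rewrite [M i j]mxE.
  by under [X in _ -> X @ _ --> _]eq_fun do rewrite mxE.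
apply: filterS slln => w cv.
pose e n := K * \sum_i \sum_j
  `|empirical_moment d n (fun k => X k w) i j - M i j|.
have e0 n : 0 <= e n.
  by rewrite mulr_ge0 // sumr_ge0 // => i _; rewrite sumr_ge0.
have cve : e n @[n --> \oo] --> (0 : R).
  rewrite -(mulr0 K); apply: cvgM; first exact: cvg_cst.
  apply: cvg0_sum => i; apply: cvg0_sum => j.
  rewrite -(@normr0 _ R); apply: cvg_norm.
  by rewrite -(subrr (M i j)); apply: cvgB => //; exact: cvg_cst.
have bound n x : (`|christoffel_emp n (fun i => X i w) d x - christoffel mu d x|
    <= (e n)%:E)%E.
  apply: christoffel_dist_le => // c.
  by apply: quad_dist_le => i; exact: hK.
apply: (@squeeze_cvge _ _ _ _ (cst 0%E) _ (fun n => (e n)%:E)).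
- apply: nearW => n; apply/andP; split.
    apply: le_trans (ereal_sup_ubound _); last by exists 0.
    exact: abse_ge0.
  by apply/ereal_supP => _ [x _ <-].
- exact: cvg_cst.
- by apply: cvg_EFin cve; exact: nearW.
Qed.
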